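(* Let $\mathbb{F}$ be a finite field with $\operatorname{char}(\mathbb{F}) \neq 2$, and let $n \geq 1$ be an integer. Let $\mathcal{S}$ be a weakly triangularizable linear subspace of the $\mathbb{F}$-vector space $\mathrm{M}_n(\mathbb{F})$ with $\dim_{\mathbb{F}} \mathcal{S} = \frac{n(n+1)}{2}$. Then $\mathcal{S}$ is similar to $\mathrm{T}_n(\mathbb{F})$, i.e., there exists $P \in \mathrm{GL}_n(\mathbb{F})$ such that $\mathcal{S} = P\, \mathrm{T}_n(\mathbb{F})\, P^{-1}$.
   Context: $\mathrm{M}_n(\mathbb{F})$ denotes the algebra of all $n \times n$ matrices with entries in $\mathbb{F}$, and $\mathrm{T}_n(\mathbb{F})$ its subalgebra of all upper-triangular matrices. A subset $\mathcal{X}$ of $\mathrm{M}_n(\mathbb{F})$ is called weakly triangularizable when each of its elements is triangularizable over $\mathbb{F}$, i.e., individually conjugate under $\mathrm{GL}_n(\mathbb{F})$ to an element of $\mathrm{T}_n(\mathbb{F})$ (the conjugating matrix may depend on the element); equivalently, each element of $\mathcal{X}$ is annihilated by a nonzero polynomial with coefficients in $\mathbb{F}$ that splits over $\mathbb{F}$. Two subsets $\mathcal{X}, \mathcal{Y}$ of $\mathrm{M}_n(\mathbb{F})$ are called similar when $\mathcal{X} = P \mathcal{Y} P^{-1}$ for some $P \in \mathrm{GL}_n(\mathbb{F})$. *)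

(* Defs.v *)
From HB Require Import structures.
From mathcomp Require Import all_boot all_order all_fingroup all_algebra.

Set Implicit Arguments.
Unset Strict Implicit.
Unset Printing Implicit Defensive.

Import GRing.Theory.
Local Open Scope ring_scope.

(* T_n(F). MathComp's [is_trig_mx] means LOWER triangular (entries with i < j
   vanish), hence the transpose. *)
Definition upper_trig_mx (F : fieldType) (n : nat) : {pred 'M[F]_n} :=
  [pred A : 'M[F]_n | is_trig_mx A^T].

Arguments upper_trig_mx : clear implicits.

Lemma upper_trig_mxP (F : fieldType) (n : nat) (A : 'M[F]_n) :
  reflect (forall i j : 'I_n, (j < i)%N -> A i j = 0)
          (A \in upper_trig_mx F n).
Proof.
rewrite inE; apply: (iffP is_trig_mxP) => H i j lt_ij.
  by have := H j i lt_ij; rewrite mxE.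
by rewrite mxE; apply: H.
Qed.

Definition triangularizable (F : fieldType) (n : nat) (A : 'M[F]_n) : Prop :=
  exists2 P : 'M[F]_n, P \in unitmx &
    exists2 B : 'M[F]_n, B \in upper_trig_mx F n & A = P *m B *m invmx P.

Definition weakly_triangularizable (F : fieldType) (n : nat)
    (X : {pred 'M[F]_n}) : Prop :=
  forall A : 'M[F]_n, A \in X -> triangularizable A.

(* The two subsets satisfy X = P Y P^-1, for a single invertible P. *)
Definition similar_subsets (F : fieldType) (n : nat)
    (X Y : {pred 'M[F]_n}) : Prop :=
  exists2 P : 'M[F]_n, P \in unitmx &
    forall A : 'M[F]_n,
      A \in X <-> exists2 B : 'M[F]_n, B \in Y & A = P *m B *m invmx P.

(* Main.v *)
Require Import Defs.
From HB Require Import structures.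
From mathcomp Require Import all_boot all_order all_fingroup all_algebra zify ring.

Set Implicit Arguments.
Unset Strict Implicit.
Unset Printing Implicit Defensive.

Import GRing.Theory.
Local Open Scope ring_scope.

(** Write [q] for the cardinal of [F]; it is odd, so [q >= 3].

    The finiteness of [F] enters through one fact about polynomials
    ([split_pencil_dvdp]): if [f - t h] splits for all [q] values of [t], with
    [deg h < deg f] and [deg f - deg h] invertible in [F], then [h] divides [f]
    and [deg f = deg h + 1].  For coprime [f] and [h], the [q] polynomials
    [f - t h] are pairwise coprime, and each divides
    [(X^q - X) (f' h - f h')], because a split polynomial divides [X^q - X]
    times its derivative, and the Wronskian is the same along the pencil.
    Comparing degrees in the divisibility of this multiple by the product of
    the [f - t h] leaves only [deg f = 1] and [deg h = 0].

    Let [S] be a space of matrices with split characteristic polynomials and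
    write its elements in bordered form [M = (a, u; v, D)], with [a] scalar.
    Since [chi_M = (X - a) chi_D - u adj(X - D) v], a matrix of [S] supported on
    the first row yields such a pencil along every [M]:
    - if [(0, r; 0, 0)] is in [S] then [r v = 0] ([row_mulmx_col_eq0]), as
      otherwise the degrees in the pencil would differ by two;
    - if [E = (1, 0; 0, 0)] is in [S] then [chi_D] divides [chi_M], so [chi_D]
      splits and [u D^k v = 0] for all [k] ([corner_block] keeps [k = 0, 1]).

    The first fact and an induction on the size give
    [\dim S <= n (n + 1) / 2] ([leq_dim_split_space]); in the case of equality
    the count also forces some [(1, r; 0, 0)] in [S] ([full_dim_corner]), which
    becomes [E] after conjugation.

    Suppose now that [S] has maximal dimension and contains [E].  By the second
    fact the blocks [D] form a space with split characteristic polynomials, and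
    the elements [(0, u; v, 0)] of [S], which satisfy [u v = 0], form a space [K]
    of dimension at most [n - 1].  So the blocks [D] have maximal dimension and,
    by induction, one may assume that they are all the upper triangular
    matrices.  Replacing [M] by [M + A] and [M - A] with [A = (0, u; v, 0)] in
    [K] then gives [u D v = 0] for every upper triangular [D], that is
    [u_i v_j = 0] for [i <= j].  A vector space is not the union of two proper
    subspaces, so for [i <= j] either [u_i] or [v_j] vanishes identically on
    [K].  Since [\dim K = n - 1], each index [i] is exactly one of: an index
    where the row [u] is free, or an index where the column [v] is free; and the
    former indices come after the latter.  Moving the first basis vector in
    between the two groups makes all of [S] upper triangular ([corner_trig]). *)

(** * Pencils of split polynomials over a finite field *)

(** Working up to a nonzero scalar makes the property stable under taking
    divisors. *)
Definition splits (F : fieldType) (p : {poly F}) : Prop :=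
  exists s : seq F, p %= \prod_(a <- s) ('X - a%:P).

Lemma splits_neq0 (F : fieldType) (p : {poly F}) : splits p -> p != 0.
Proof.
case=> s /eqp_size ps; rewrite -size_poly_gt0 ps.
by rewrite size_prod_XsubC.
Qed.

Lemma splits_dvdp (F : fieldType) (d p : {poly F}) :
  d %| p -> splits p -> splits d.
Proof.
move=> dp [s ps]; move: dp; rewrite (eqp_dvdr _ ps) => dp.
have [m dm] := dvdp_prod_XsubC dp.
by exists (mask m s).
Qed.

(** A root of multiplicity [k] has multiplicity at least [k - 1] in the
    derivative, and the product over [F] supplies the missing factor. *)
Lemma splits_dvd_deriv (F : finFieldType) (p : {poly F}) :
  splits p -> p %| (\prod_(a : F) ('X - a%:P)) * p^`().
Proof.
set G := \prod_(a : F) _; case=> s; elim: s p => [|a s IHs] p.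
  by rewrite big_nil => /eqp_dvdl->; apply: dvd1p.
rewrite big_cons; set P := \prod_(b <- s) _ => /eqpf_eq [c c0 ->].
have IH : P %| G * P^`() by apply: IHs; apply: eqpxx.
rewrite dvdpZl // derivZ -scalerAr dvdpZr // derivM derivXsubC mul1r mulrDr.
apply: dvdp_add.
  by apply: dvdp_mul => //; rewrite /G (bigD1 a) //= dvdp_mulr.
by rewrite mulrCA dvdp_mul.
Qed.

Lemma dvdp_prod_coprime (F : fieldType) (I : eqType) (r : seq I)
    (P : I -> {poly F}) (w : {poly F}) :
  uniq r -> (forall i j, i != j -> coprimep (P i) (P j)) ->
  (forall i, P i %| w) -> \prod_(i <- r) P i %| w.
Proof.
move=> + copP Pw; elim: r => [|i r IHr] /=; first by rewrite big_nil dvd1p.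
case/andP=> ir ur; rewrite big_cons Gauss_dvdp ?Pw ?IHr //.
elim: r ir {ur IHr} => [|j r IHr]; first by rewrite big_nil coprimep1.
by rewrite inE negb_or big_cons coprimepMr => /andP[/copP-> /IHr].
Qed.

Lemma deriv_eq0_natr (F : fieldType) (p : {poly F}) :
  p != 0 -> p^`() = 0 -> (size p).-1%:R = 0 :> F.
Proof.
move=> p0 p'0; case Ep: (size p).-1 => [|k] //.
have: p^`()`_k = 0 by rewrite p'0 coef0.
rewrite coef_deriv -Ep => /eqP.
rewrite -[_ *+ _]mulr_natr mulf_eq0 -lead_coefE lead_coef_eq0 (negPf p0).
by move/eqP.
Qed.

(** If [f' h = f h'] then [f] divides [f'] by coprimality, so both derivatives
    vanish, and the characteristic divides both degrees. *)
Lemma wronskian_neq0 (F : fieldType) (f h : {poly F}) :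
  coprimep f h -> f != 0 -> h != 0 ->
  (size f)%:R != (size h)%:R :> F -> f^`() * h - f * h^`() != 0.
Proof.
move=> cop f0 h0; apply: contraNneq => /eqP; rewrite subr_eq0 => /eqP Efh.
have f'0 : f^`() = 0.
  have: f %| f^`().
    by rewrite -(Gauss_dvdpl _ cop) Efh dvdp_mulr.
  by apply: contraTeq => f'0; rewrite gtNdvdp ?lt_size_deriv.
have h'0 : h^`() = 0.
  by move: Efh; rewrite f'0 mul0r => /esym/eqP; rewrite mulf_eq0 (negPf f0) => /eqP.
have /eqP := deriv_eq0_natr f0 f'0; have /eqP := deriv_eq0_natr h0 h'0.
rewrite -{2}(prednK (n := size f)) ?size_poly_gt0 //.
rewrite -{2}(prednK (n := size h)) ?size_poly_gt0 // -!natr1.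
by move=> /eqP-> /eqP->.
Qed.

(** The members of the pencil are pairwise coprime and share the Wronskian of
    [f] and [h], so that their product divides [(X^q - X) (f' h - f h')].  With
    [m = deg f] and [d = deg h] this gives [m q <= q + m + d - 1], whence
    [(m - 1) (q - 2) <= 0]. *)
Lemma split_pencil_coprime (F : finFieldType) (f h : {poly F}) :
  (2 < #|F|)%N -> coprimep f h -> h != 0 -> (size h < size f)%N ->
  (size f)%:R != (size h)%:R :> F ->
  (forall t : F, splits (f - t *: h)) ->
  size f = 2%N /\ size h = 1%N.
Proof.
move=> q2 cop h0 szhf szF spl.
have f0 : f != 0 by rewrite -size_poly_gt0 (leq_trans _ szhf).
pose W := f^`() * h - f * h^`(); pose G := \prod_(a : F) ('X - a%:P).
have W0 : W != 0 by apply: wronskian_neq0.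
have szP t : size (f - t *: h) = size f.
  by rewrite size_polyDl // size_polyN (leq_ltn_trans (size_scale_leq _ _)).
have copP t u : t != u -> coprimep (f - t *: h) (f - u *: h).
  move=> tu; have copt : coprimep (f - t *: h) h.
    by rewrite coprimep_sym addrC -mul_polyC -mulNr coprimep_addl_mul coprimep_sym.
  have -> : f - u *: h = 1 * (f - t *: h) + (t - u) *: h.
    by rewrite mul1r scalerBl addrA subrK.
  by rewrite coprimep_addl_mul coprimepZr // subr_eq0.
have dvdW t : f - t *: h %| G * W.
  have -> : W = (f - t *: h)^`() * h - (f - t *: h) * h^`().
    rewrite /W derivB derivZ !mulrBl opprB -!scalerAl [h^`() * h]mulrC.
    by rewrite addrA subrK.
  rewrite mulrBr; apply: dvdp_sub; last by rewrite dvdp_mull // dvdp_mulr.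
  by rewrite mulrA dvdp_mulr // splits_dvd_deriv.
have := dvdp_prod_coprime (enum_uniq F) copP dvdW.
have GW0 : G * W != 0.
  by rewrite mulf_neq0 // prodf_seq_neq0; apply/allP=> a _; rewrite polyXsubC_eq0.
move/(dvdp_leq GW0).
have szG : size G = #|F|.+1 by rewrite size_prod_XsubC cardE enumT.
rewrite size_prod_seq => [|t _]; last by apply: splits_neq0.
under eq_bigr do rewrite szP.
rewrite big_const_seq count_predT iter_addn_0 -cardE.
rewrite size_mul ?szG //=; last by rewrite -size_poly_gt0 szG.
have szW : (size W <= (size f + size h).-2)%N.
  have hpos : (0 < size h)%N by rewrite size_poly_gt0.
  have fpos : (0 < size f)%N by rewrite size_poly_gt0.
  have f'le := lt_size_deriv f0; have h'le := lt_size_deriv h0.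
  apply: leq_trans (size_polyD _ _) _; rewrite size_polyN geq_max.
  apply/andP; split; apply: leq_trans (size_polyMleq _ _) _.
    by rewrite -!subn1 leq_sub2r // leq_subRL ?addn_gt0 ?fpos // add1n -addSn leq_add2r.
  by rewrite -!subn1 leq_sub2r // leq_subRL ?addn_gt0 ?fpos // add1n -addnS leq_add2l.
have hpos : (0 < size h)%N by rewrite size_poly_gt0.
move: q2 szW hpos szhf; clear.
move: (size f) (size h) (size W) #|F| => m d w q q2 wle d0 dm.
nia.
Qed.

(** Dividing the pencil by [gcd(f, h)] keeps its members split and preserves the
    difference of the degrees. *)
Lemma split_pencil_dvdp (F : finFieldType) (f h : {poly F}) :
  (2 < #|F|)%N -> h != 0 -> (size h < size f)%N ->
  (size f - size h)%:R != 0 :> F ->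
  (forall t : F, splits (f - t *: h)) ->
  size f = (size h).+1 /\ h %| f.
Proof.
move=> q2 h0 szhf szF spl.
set g := gcdp f h; have g0 : g != 0 by rewrite gcdp_eq0 (negPf h0) andbF.
have Ef : f = f %/ g * g by rewrite divpK // dvdp_gcdl.
have Eh : h = h %/ g * g by rewrite divpK // dvdp_gcdr.
have cop : coprimep (f %/ g) (h %/ g) by rewrite coprimep_div_gcd // h0 orbT.
move: (f %/ g) (h %/ g) cop Ef Eh => f1 h1 cop Ef Eh.
have h10 : h1 != 0 by apply: contraNneq h0; rewrite Eh => ->; rewrite mul0r.
have f0 : f != 0 by rewrite -size_poly_gt0 (leq_trans _ szhf).
have f10 : f1 != 0 by apply: contraNneq f0; rewrite Ef => ->; rewrite mul0r.
have gpos : (0 < size g)%N by rewrite size_poly_gt0.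
have f1pos : (0 < size f1)%N by rewrite size_poly_gt0.
have h1pos : (0 < size h1)%N by rewrite size_poly_gt0.
have szf : size f = (size f1 + size g).-1 by rewrite Ef size_mul.
have szh : size h = (size h1 + size g).-1 by rewrite Eh size_mul.
have szlt : (size h1 < size f1)%N by lia.
have szE : (size f - size h = size f1 - size h1)%N by lia.
case: (@split_pencil_coprime F f1 h1) => //.
- by rewrite -subr_eq0 -natrB ?(ltnW szlt) // -szE.
- move=> t; apply: splits_dvdp (spl t).
  by rewrite Ef Eh scalerAl -mulrBl dvdp_mulr.
move=> sf1 sh1; split; first by rewrite szf szh sf1 sh1; lia.
have /eqp_dvdl h1f1 : h1 %= 1 by rewrite -size_poly_eq1 sh1.
by rewrite Ef {1}Eh dvdp_mul // h1f1 dvd1p.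
Qed.

(** * Characteristic polynomials of bordered matrices *)

Section BlockCharPoly.

Variables (F : fieldType) (m : nat).
Implicit Types (D : 'M[F]_m) (u : 'rV[F]_m) (v : 'cV[F]_m).

Definition adj_form u D v : {poly F} :=
  (map_mx polyC u *m \adj (char_poly_mx D) *m map_mx polyC v) 0 0.

(** Schur complement formula, made division free: multiplying the bordered
    matrix by [(chi_D, 0; adj(X - D) v, 1)] clears its lower left block. *)
Lemma char_poly_block a u v D :
  char_poly (block_mx a u v D : 'M_(1 + m)) =
  ('X - (a 0 0)%:P) * char_poly D - adj_form u D v.
Proof.
set Q := \adj (char_poly_mx D).
have chi0 : char_poly D != 0 by rewrite monic_neq0 // char_poly_monic.
have EM : char_poly_mx (block_mx a u v D : 'M_(1 + m)) =
  block_mx ('X - (a 0 0)%:P)%:M (- map_mx polyC u)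
           (- map_mx polyC v) (char_poly_mx D).
  rewrite /char_poly_mx map_block_mx (scalar_mx_block (1:nat) m).
  rewrite opp_block_mx add_block_mx !add0r; congr block_mx; apply/matrixP=> i j.
  by rewrite !ord1 !mxE.
apply: (mulIf chi0).
have -> : char_poly (block_mx a u v D : 'M_(1 + m)) * char_poly D =
  \det (block_mx ('X - (a 0 0)%:P)%:M (- map_mx polyC u)
           (- map_mx polyC v) (char_poly_mx D) *m
        block_mx (char_poly D)%:M 0 (Q *m map_mx polyC v) 1%:M).
  by rewrite det_mulmx det_lblock det1 mulr1 det_scalar1 -EM.
rewrite mulmx_block !mulmx0 !mulmx1 !add0r !mulmxA mul_mx_adj -/(char_poly D).
have -> : - map_mx polyC v *m (char_poly D)%:M + (char_poly D)%:M *m map_mx polyC v = 0.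
  by rewrite mul_mx_scalar mul_scalar_mx scalerN addNr.
rewrite det_ublock.
have EQ : map_mx polyC u *m Q *m map_mx polyC v = (adj_form u D v)%:M.
  by rewrite [LHS]mx11_scalar.
by rewrite !mulNmx EQ -scalar_mxM -raddfB /= det_scalar1.
Qed.

(** From [X adj(X - D) = D adj(X - D) + chi_D]; this recurrence gives access to
    the scalars [u D^k v] without expanding the adjugate. *)
Lemma adj_formX u D v :
  'X * adj_form u D v =
  adj_form (u *m D) D v + ((u *m v) 0 0)%:P * char_poly D.
Proof.
rewrite /adj_form map_mxM; set Q := \adj _.
have EQ : 'X *: Q = map_mx polyC D *m Q + (char_poly D)%:M.
  rewrite -mul_mx_adj -mulmxDl /char_poly_mx addrC subrK.
  by rewrite mul_scalar_mx.
have -> : 'X * (map_mx polyC u *m Q *m map_mx polyC v) 0 0 =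
   (map_mx polyC u *m ('X *: Q) *m map_mx polyC v) 0 0.
  by rewrite -scalemxAr -scalemxAl !mxE.
rewrite EQ mulmxDr mulmxDl mxE !mulmxA; congr (_ + _).
rewrite mul_mx_scalar -scalemxAl mxE mulrC; congr (_ * _).
by rewrite -map_mxM mxE.
Qed.

(** The form is a difference of two characteristic polynomials of size [m + 2]
    with the same leading coefficient and the same trace. *)
Lemma size_adj_form u D v : (size (adj_form u D v) <= m)%N.
Proof.
have -> : adj_form u D v =
  char_poly (block_mx 0 0 0 D : 'M_(1 + m)) - char_poly (block_mx 0 u v D : 'M_(1 + m)).
  rewrite !char_poly_block.
  have -> : adj_form 0 D 0 = 0 by rewrite /adj_form map_mx0 !mul0mx mxE.
  by rewrite subr0 opprB addrC subrK.
apply/leq_sizeP=> j; rewrite coefB leq_eqVlt => /predU1P[<-|].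
  have tr0 (A : 'M[F]_(1 + m)) : (char_poly A)`_m = - \tr A by apply: char_poly_trace.
  by rewrite !tr0 !mxtrace_block subrr.
rewrite leq_eqVlt => /predU1P[<-|jm].
  have lc1 A : (char_poly (A : 'M[F]_(1 + m)))`_m.+1 = 1.
    by have := monicP (char_poly_monic A); rewrite lead_coefE size_char_poly.
  by rewrite !lc1 subrr.
by rewrite !nth_default ?subrr // size_char_poly.
Qed.

Lemma coef_adj_form u D v : (0 < m)%N -> (adj_form u D v)`_m.-1 = (u *m v) 0 0.
Proof.
move=> m0; have /(congr1 (fun p : {poly F} => p`_m)) := adj_formX u D v.
rewrite coefXM (gtn_eqF m0) => ->; rewrite coefD coefCM.
rewrite [_`_m]nth_default ?size_adj_form // add0r.
have := monicP (char_poly_monic D); rewrite lead_coefE size_char_poly => ->.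
by rewrite mulr1.
Qed.

Lemma adj_form_eq0 u D v :
  adj_form u D v = 0 -> u *m v = 0 /\ adj_form (u *m D) D v = 0.
Proof.
move=> Q0; have := adj_formX u D v; rewrite Q0 mulr0.
have uv0 : (u *m v) 0 0 = 0.
  have [m0|] := posnP m; last by move/(coef_adj_form u D v) => <-; rewrite Q0 coef0.
  by rewrite mxE big1 // => -[i lti]; exfalso; rewrite m0 in lti.
rewrite uv0 mul0r addr0 => <-; split=> //.
by apply/matrixP=> i j; rewrite !ord1 uv0 mxE.
Qed.

End BlockCharPoly.

Lemma card_gt2 (F : finFieldType) : 2%N \notin [pchar F] -> (2 < #|F|)%N.
Proof.
move=> ch; have two0 : 2%:R != 0 :> F.
  by apply: contra ch; rewrite inE.
have /card_uniqP : uniq [:: 0; 1; -1 : F].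
  rewrite /= !inE !negb_or eq_sym oner_eq0 eq_sym oppr_eq0 oner_eq0 /=.
  by rewrite -addr_eq0 two0.
by move=> /= <-; apply: max_card.
Qed.

Definition split_space (F : fieldType) (n : nat) (S : {vspace 'M[F]_n}) : Prop :=
  forall A, A \in S -> splits (char_poly A).

Section Pencils.

Variables (F : finFieldType) (m : nat) (S : {vspace 'M[F]_(1 + m)}).
Hypothesis ch2 : 2%N \notin [pchar F].
Hypothesis splS : split_space S.

(** The pencil of [chi_M] along the first matrix has direction
    [adj_form r D v], whose coefficient of degree [m - 1] is [r v].  Were it
    nonzero, the degrees in the pencil would differ by two. *)
Lemma row_mulmx_col_eq0 (r : 'rV[F]_m) a u v D :
  block_mx 0 r 0 0 \in S -> block_mx a u v D \in S -> r *m v = 0.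
Proof.
move=> rS MS; apply/matrixP=> i j; rewrite !ord1 [RHS]mxE.
apply/eqP/negPn/negP => rv0.
have m0 : (0 < m)%N.
  rewrite lt0n; apply: contraNneq rv0 => m0; rewrite mxE big1 // => -[k ltk].
  by exfalso; rewrite m0 in ltk.
have co := coef_adj_form r D v m0.
have szh : size (adj_form r D v) = m.
  apply/eqP; rewrite eqn_leq size_adj_form /= -[X in (X <= _)%N](prednK m0).
  rewrite ltnNge; apply/negP=> /leq_sizeP/(_ _ (leqnn _)) /eqP.
  by rewrite co (negPf rv0).
have szf := size_char_poly (block_mx a u v D : 'M_(1 + m)).
case: (@split_pencil_dvdp F
        (char_poly (block_mx a u v D : 'M_(1 + m))) (adj_form r D v)).
- exact: card_gt2.
- by rewrite -size_poly_gt0 szh.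
- by rewrite szf szh.
- by rewrite szf szh subSn // subSn // subnn; apply: contra ch2; rewrite inE.
- move=> t; have : block_mx a u v D + t *: block_mx 0 r 0 0 \in S.
    by rewrite memvD // memvZ.
  move/splS; rewrite scale_block_mx add_block_mx !scaler0 !addr0.
  rewrite !char_poly_block /adj_form map_mxD map_mxZ !mulmxDl -!scalemxAl.
  by rewrite mxE [fun_of_matrix (_ *: _) _ _]mxE mul_polyC opprD addrA.
by rewrite szf szh; lia.
Qed.

(** Along the corner idempotent, the pencil of [chi_M] has direction [chi_D],
    which therefore divides [chi_M] and hence also [adj_form u D v]; the latter
    has smaller degree. *)
Lemma corner_block a u v D :
  block_mx 1%:M 0 0 0 \in S -> block_mx a u v D \in S ->
  [/\ u *m v = 0, u *m D *m v = 0 & splits (char_poly D)].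
Proof.
move=> ES MS; set M : 'M_(1 + m) := block_mx a u v D.
have szf := size_char_poly M.
case: (@split_pencil_dvdp F (char_poly M) (char_poly D)).
- exact: card_gt2.
- by rewrite monic_neq0 ?char_poly_monic.
- by rewrite szf size_char_poly.
- by rewrite szf size_char_poly subSn // subnn oner_neq0.
- move=> t; have : M + t *: block_mx 1%:M 0 0 0 \in S.
    by rewrite memvD // memvZ.
  move/splS; rewrite scale_block_mx add_block_mx !scaler0 !addr0.
  rewrite !char_poly_block !mxE mulr1 polyCD opprD addrA mulrBl.
  by rewrite mul_polyC -!addrA [- _ - adj_form _ _ _]addrC.
move=> _ dv; have uDv0 : adj_form u D v = 0.
  apply/eqP; apply: contraTT dv => Q0.
  rewrite char_poly_block dvdp_subr ?dvdp_mulIr //.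
  by rewrite gtNdvdp // size_char_poly ltnS size_adj_form.
have [uv0 /adj_form_eq0[uDv _]] := adj_form_eq0 uDv0.
by split=> //; apply: splits_dvdp dv _; apply: splS.
Qed.

End Pencils.

(** * The dimension bound and the existence of a corner idempotent *)

Lemma leq_dim_orthogonal (F : fieldType) (m : nat)
    (U : {vspace 'rV[F]_m}) (V : {vspace 'cV[F]_m}) :
  (forall u v, u \in U -> v \in V -> u *m v = 0) -> (\dim U + \dim V <= m)%N.
Proof.
move=> UV.
pose A := \matrix_(i < \dim U) (vbasis U)`_i.
pose B := \matrix_(j < \dim V) ((vbasis V)`_j)^T.
have rA : row_free A.
  rewrite -kermx_eq0; apply/rowV0P=> w /sub_kermxP wA0.
  apply/rowP=> i; rewrite [RHS]mxE; move: i.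
  have /freeP := basis_free (vbasisP U); apply.
  by rewrite -[RHS]wA0 mulmx_sum_row; apply: eq_bigr => k _; rewrite rowK.
have rB : row_free B.
  rewrite -kermx_eq0; apply/rowV0P=> w /sub_kermxP wB0.
  apply/rowP=> i; rewrite [RHS]mxE; move: i.
  have /freeP := basis_free (vbasisP V); apply.
  apply: trmx_inj; rewrite trmx0 -[RHS]wB0 mulmx_sum_row linear_sum.
  by apply: eq_bigr => k _; rewrite linearZ rowK.
have AB0 : A *m B^T = 0.
  apply/matrixP=> i j; rewrite [RHS]mxE.
  have /matrixP/(_ 0 0) : (vbasis U)`_i *m (vbasis V)`_j = 0.
    by apply: UV; apply: vbasis_mem; apply: mem_nth; rewrite size_tuple.
  by rewrite !mxE => E0; rewrite -[RHS]E0; apply: eq_bigr => k _; rewrite !mxE.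
have := mulmx0_rank_max AB0.
by rewrite mxrank_tr (eqP rA) (eqP rB).
Qed.

Section BlockMaps.

Variables (F : fieldType) (m : nat).

(** The four block projections, bundled as linear maps so that the rank-nullity
    theorem applies to them. *)
Definition ulL : 'Hom('M[F]_(1 + m), 'M[F]_1) := linfun (lsubmx \o usubmx).
Definition urL : 'Hom('M[F]_(1 + m), 'rV[F]_m) := linfun (rsubmx \o usubmx).
Definition dlL : 'Hom('M[F]_(1 + m), 'cV[F]_m) := linfun (lsubmx \o dsubmx).
Definition drL : 'Hom('M[F]_(1 + m), 'M[F]_m) := linfun (rsubmx \o dsubmx).

Lemma ulLE A : ulL A = ulsubmx A. Proof. by rewrite lfunE. Qed.
Lemma urLE A : urL A = ursubmx A. Proof. by rewrite lfunE. Qed.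
Lemma dlLE A : dlL A = dlsubmx A. Proof. by rewrite lfunE. Qed.
Lemma drLE A : drL A = drsubmx A. Proof. by rewrite lfunE. Qed.

Definition blockLE := (ulLE, urLE, dlLE, drLE).

End BlockMaps.

Lemma leq_dim_ul (F : fieldType) (m : nat) (U : {vspace 'M[F]_(1 + m)}) :
  (\dim U <= (\dim (U :&: lker (ulL F m))).+1)%N.
Proof.
rewrite -(limg_ker_dim (ulL F m) U) -[X in (_ <= X)%N]addn1 leq_add2l.
by apply: leq_trans (dimvS (subvf _)) _; rewrite dimvf /dim /= mul1n.
Qed.

Section DimensionStep.

Variables (F : finFieldType) (m : nat) (S : {vspace 'M[F]_(1 + m)}).
Hypothesis ch2 : 2%N \notin [pchar F].
Hypothesis splS : split_space S.

(* The filtration behind the count: vanishing first column below the corner,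
   then support in the first row, then zero corner. *)
Let C0 := (S :&: lker (dlL F m))%VS.
Let U0 := (C0 :&: lker (drL F m))%VS.
Let R0 := (U0 :&: lker (ulL F m))%VS.

Lemma split_space_compression : split_space (drL F m @: C0)%VS.
Proof.
move=> _ /memv_imgP[A /memv_capP[AS Adl] ->].
have dl0 : dlsubmx A = 0 by apply/eqP; rewrite -dlLE -memv_ker.
rewrite drLE; apply: splits_dvdp (splS AS).
rewrite -[X in _ %| char_poly X](submxK A) dl0 char_poly_block.
have -> : adj_form (ursubmx A) (drsubmx A) 0 = 0.
  by rewrite /adj_form map_mx0 mulmx0 mxE.
by rewrite subr0 dvdp_mull.
Qed.

(** By [row_mulmx_col_eq0], the rows coming from [R0] are orthogonal to all the
    columns that occur in [S]. *)
Lemma leq_dim_row_col : (\dim R0 + \dim (dlL F m @: S) <= m)%N.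
Proof.
have inj : (R0 :&: lker (urL F m) = 0)%VS.
  apply/eqP; rewrite -subv0; apply/subvP=> A.
  rewrite !memv_cap !memv_ker !blockLE.
  move=> /andP[/andP[/andP[/andP[_ /eqP dl0] /eqP dr0] /eqP ul0] /eqP ur0].
  by rewrite -[A]submxK ul0 ur0 dl0 dr0 block_mx0 mem0v.
rewrite -(limg_dim_eq inj); apply: leq_dim_orthogonal.
move=> _ _ /memv_imgP[A AR ->] /memv_imgP[B BS ->]; move: AR.
rewrite !memv_cap !memv_ker !blockLE.
case/andP=> /andP[/andP[AS /eqP dl0] /eqP dr0] /eqP ul0.
apply: (row_mulmx_col_eq0 ch2 splS (a := ulsubmx B) (u := ursubmx B) (D := drsubmx B)).
  by move: AS; rewrite -[X in X \in S](submxK A) ul0 dl0 dr0.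
by rewrite submxK.
Qed.

Lemma leq_dim_compression :
  (\dim S <= m.+1 + \dim (drL F m @: C0))%N.
Proof.
have ES : (\dim C0 + \dim (dlL F m @: S) = \dim S)%N := limg_ker_dim _ S.
have EC : (\dim U0 + \dim (drL F m @: C0) = \dim C0)%N := limg_ker_dim _ C0.
have EU : (\dim U0 <= (\dim R0).+1)%N := leq_dim_ul U0.
move: leq_dim_row_col ES EC EU.
move: (\dim R0) (\dim _) (\dim U0) (\dim _) (\dim C0) (\dim S) => *; lia.
Qed.

(** In the case of equality a matrix supported on the first row must have a
    nonzero corner; otherwise one dimension is lost in the count. *)
Lemma full_dim_corner :
  (m.+1 + \dim (drL F m @: C0) <= \dim S)%N ->
  exists r, block_mx 1%:M r 0 0 \in S.
Proof.
have ES : (\dim C0 + \dim (dlL F m @: S) = \dim S)%N := limg_ker_dim _ S.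
have EC : (\dim U0 + \dim (drL F m @: C0) = \dim C0)%N := limg_ker_dim _ C0.
move=> le_S; have /subvPn[A AU0] : ~~ (U0 <= lker (ulL F m))%VS.
  apply/negP=> /capv_idPl EU; move: leq_dim_row_col le_S ES EC; rewrite /R0 EU.
  by move: (\dim _) (\dim _) (\dim U0) (\dim C0) (\dim S) => *; lia.
rewrite memv_ker ulLE; move: AU0; rewrite !memv_cap !memv_ker !blockLE.
move=> /andP[/andP[AS /eqP dl0] /eqP dr0]; set a := ulsubmx A 0 0 => ul0.
have a0 : a != 0.
  by apply: contraNneq ul0 => a0; apply/eqP/matrixP=> i j; rewrite !ord1 [RHS]mxE.
exists (a^-1 *: ursubmx A).
have := memvZ a^-1 AS; rewrite -[X in _ *: X \in S](submxK A) dl0 dr0.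
by rewrite scale_block_mx !scaler0 [ulsubmx A]mx11_scalar -/a scale_scalar_mx mulVf.
Qed.

End DimensionStep.

Lemma binS2 m : 'C(m.+2, 2) = (m.+1 + 'C(m.+1, 2))%N.
Proof. by rewrite binS bin1 addnC. Qed.

Lemma leq_dim_split_space (F : finFieldType) (n : nat) (S : {vspace 'M[F]_n}) :
  2%N \notin [pchar F] -> split_space S -> (\dim S <= 'C(n.+1, 2))%N.
Proof.
move=> ch2; elim: n S => [|m IHm] S splS.
  by apply: leq_trans (dimvS (subvf _)) _; rewrite dimvf /dim.
apply: leq_trans (leq_dim_compression (m := m) ch2 splS) _.
by rewrite binS2 leq_add2l IHm //; apply: split_space_compression.
Qed.

(** Counting the pairs column by column: there are [j + 1] of them with second
    component [j]. *)
Lemma card_leq_pairs n : #|[pred p : 'I_n * 'I_n | (p.1 <= p.2)%N]| = 'C(n.+1, 2).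
Proof.
have -> : 'C(n.+1, 2) = (\sum_(j < n) j.+1)%N.
  by rewrite -bin2_sum big_mkord big_ord_recl.
rewrite -sum1_card.
rewrite -(pair_big_dep xpredT (fun i j : 'I_n => (i <= j)%N) (fun _ _ => 1%N)) /=.
rewrite (exchange_big_dep xpredT) //=; apply: eq_bigr => j _.
rewrite (big_ord_narrow_cond (P := xpredT) (F := fun=> 1%N) (ltn_ord j)).
by rewrite sum1_card card_ord.
Qed.

(** * Simultaneous triangularization and conjugation *)

(** The upper triangular matrices are spanned by ['C(n.+1, 2)] elementary
    matrices. *)
Lemma upper_sub_full_dim (F : fieldType) (n : nat) (S : {vspace 'M[F]_n}) :
  (forall A, A \in S -> A \in upper_trig_mx F n) ->
  ('C(n.+1, 2) <= \dim S)%N ->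
  forall A, A \in upper_trig_mx F n -> A \in S.
Proof.
move=> upS dimS.
pose L := image (fun p => delta_mx p.1 p.2 : 'M[F]_n)
  [pred p : 'I_n * 'I_n | (p.1 <= p.2)%N].
have upL A : A \in upper_trig_mx F n -> A \in <<L>>%VS.
  move/upper_trig_mxP=> upA; rewrite (matrix_sum_delta A).
  apply: memv_suml => i _; apply: memv_suml => j _.
  have [ij|ji] := leqP i j; last by rewrite upA // scale0r mem0v.
  apply: memvZ; apply: memv_span; apply/imageP; exists (i, j) => //.
suff -> : S = <<L>>%VS by [].
apply/eqP; rewrite eqEdim; apply/andP; split.
  by apply/subvP=> A /upS/upL.
apply: leq_trans (dim_span _) _.
by rewrite size_image card_leq_pairs.
Qed.

Lemma invmx_uniq (F : fieldType) (n : nat) (P Q : 'M[F]_n) :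
  P *m Q = 1%:M -> invmx P = Q.
Proof.
by move=> PQ1; have [Pu _] := mulmx1_unit PQ1; rewrite -[LHS]mulmx1 -PQ1 mulKmx.
Qed.

Definition simultaneously_trig (F : fieldType) (n : nat)
    (S : {vspace 'M[F]_n}) : Prop :=
  exists2 P : 'M[F]_n, P \in unitmx &
    forall A, A \in S -> invmx P *m A *m P \in upper_trig_mx F n.

Section Conjugation.

Variables (F : fieldType) (n : nat) (P : 'M[F]_n).
Hypothesis Pu : P \in unitmx.

Definition conjL : 'End('M[F]_n) := linfun (mulmxr P \o mulmx (invmx P)).

Lemma conjLE A : conjL A = invmx P *m A *m P.
Proof. by rewrite lfunE. Qed.

Lemma dim_conj (S : {vspace 'M[F]_n}) : \dim (conjL @: S) = \dim S.
Proof.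
apply: limg_dim_eq; apply/eqP; rewrite -subv0; apply/subvP=> A.
rewrite memv_cap memv_ker conjLE memv0 => /andP[_ /eqP PAP].
have := congr1 (fun B => P *m B *m invmx P) PAP.
by rewrite mulmx0 mul0mx !mulmxA mulmxV // mul1mx -mulmxA mulmxV // mulmx1 => ->.
Qed.

Lemma char_poly_conj A : char_poly (invmx P *m A *m P) = char_poly A.
Proof.
have E : char_poly_mx (invmx P *m A *m P) =
    map_mx polyC (invmx P) *m char_poly_mx A *m map_mx polyC P.
  rewrite /char_poly_mx mulmxBr mulmxBl -!map_mxM; congr (_ - _).
  by rewrite scalar_mxC -mulmxA -map_mxM mulVmx // map_mx1 mulmx1.
rewrite /char_poly E !det_mulmx mulrC mulrA -det_mulmx -map_mxM mulmxV //.
by rewrite map_mx1 det1 mul1r.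
Qed.

Lemma split_space_conj (S : {vspace 'M[F]_n}) :
  split_space S -> split_space (conjL @: S)%VS.
Proof.
by move=> splS _ /memv_imgP[A AS ->]; rewrite conjLE char_poly_conj; apply: splS.
Qed.

Lemma simultaneously_trig_conj (S : {vspace 'M[F]_n}) :
  simultaneously_trig (conjL @: S)%VS -> simultaneously_trig S.
Proof.
case=> Q Qu trigQ; exists (P *m Q) => [|A AS]; first by rewrite unitmx_mul Pu.
have EI : invmx (P *m Q) = invmx Q *m invmx P.
  by apply: invmx_uniq; rewrite mulmxA -[P *m Q *m _]mulmxA mulmxV // mulmx1 mulmxV.
by have := trigQ _ (memv_img conjL AS); rewrite conjLE EI !mulmxA.
Qed.

End Conjugation.

Lemma upward_closed_threshold (m : nat) (I : pred 'I_m) :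
  (forall i j : 'I_m, (i <= j)%N -> I i -> I j) ->
  exists k : 'I_m.+1, forall i : 'I_m, I i = (k <= i)%N.
Proof.
move=> upI; case: (pickP I) => [i0 Ii0|I0]; last first.
  by exists ord_max => i; rewrite I0 leqNgt ltn_ord.
case: (arg_minnP (fun i : 'I_m => i : nat) Ii0) => k Ik kmin.
exists (widen_ord (leqnSn m) k) => i; apply/idP/idP; first exact: kmin.
by move=> ki; apply: upI Ik.
Qed.

(** * Spaces containing the corner idempotent *)

Section CornerKernel.

Variables (F : finFieldType) (m : nat) (S : {vspace 'M[F]_(1 + m)}).
Hypothesis ch2 : 2%N \notin [pchar F].
Hypothesis splS : split_space S.
Hypothesis ES : block_mx 1%:M 0 0 0 \in S.

Definition cross_space : {vspace 'M[F]_(1 + m)} :=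
  (S :&: lker (drL F m) :&: lker (ulL F m))%VS.

Lemma cross_spaceP A :
  reflect (A \in S /\ A = block_mx 0 (ursubmx A) (dlsubmx A) 0) (A \in cross_space).
Proof.
rewrite !memv_cap !memv_ker !blockLE; apply: (iffP idP).
  move=> /andP[/andP[AS /eqP dr0] /eqP ul0]; split=> //.
  by rewrite -[LHS]submxK dr0 ul0.
case=> AS EA; rewrite AS /=; rewrite EA block_mxKdr block_mxKul.
by rewrite !eqxx.
Qed.

Lemma corner_submx A : A \in S -> 
  [/\ ursubmx A *m dlsubmx A = 0, ursubmx A *m drsubmx A *m dlsubmx A = 0
    & splits (char_poly (drsubmx A))].
Proof.
move=> AS; apply: (corner_block ch2 splS (a := ulsubmx A)) => //.
by rewrite submxK.
Qed.

(** The columns [v] with [(0, 0; v, 0)] in the space are orthogonal to all its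
    rows: [u v] vanishes on each element, hence on the sum of two. *)
Lemma leq_dim_cross : (\dim cross_space <= m)%N.
Proof.
set K := cross_space.
have inj : (K :&: lker (urL F m) :&: lker (dlL F m) = 0)%VS.
  apply/eqP; rewrite -subv0; apply/subvP=> A.
  rewrite memv_cap memv_cap !memv_ker !blockLE.
  move=> /andP[/andP[/cross_spaceP[_ EA] /eqP ur0] /eqP dl0].
  by rewrite EA ur0 dl0 block_mx0 mem0v.
rewrite -(limg_ker_dim (urL F m) K) -(limg_dim_eq inj) addnC.
apply: leq_dim_orthogonal => _ _ /memv_imgP[A AK ->] /memv_imgP[B + ->].
rewrite memv_cap memv_ker !blockLE => /andP[BK /eqP ur0].
have [AS _] := cross_spaceP _ AK; have [BS _] := cross_spaceP _ BK.
have [uv _ _] := corner_submx AS; have [] := corner_submx (memvD AS BS).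
have -> : ursubmx (A + B) = ursubmx A by rewrite -[LHS]urLE linearD /= !urLE ur0 addr0.
by rewrite -[dlsubmx (A + B)]dlLE linearD /= !dlLE mulmxDr uv add0r.
Qed.

Lemma split_space_dr : split_space (drL F m @: S)%VS.
Proof. by move=> _ /memv_imgP[A /corner_submx[_ _ ?] ->]; rewrite drLE. Qed.

Lemma leq_dim_corner : (\dim S <= m.+1 + \dim (drL F m @: S))%N.
Proof.
have := leq_dim_cross; have := limg_ker_dim (drL F m) S.
have := leq_dim_ul (S :&: lker (drL F m)); rewrite -/cross_space.
move: (\dim _) (\dim _) (\dim _) (\dim _) => *; lia.
Qed.

End CornerKernel.

(** Adding the last two equations, and using the first, gives twice the
    conclusion. *)
Lemma parallelogram_eq0 (F : fieldType) (m : nat) (u r : 'rV[F]_m) (D : 'M[F]_m)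
    (v c : 'cV[F]_m) :
  2%N \notin [pchar F] -> u *m D *m v = 0 ->
  (u + r) *m D *m (v + c) = 0 -> (u - r) *m D *m (v - c) = 0 ->
  r *m D *m c = 0.
Proof.
move=> ch2 e0 eP eM; have : 2%:R *: (r *m D *m c) = 0.
  rewrite -(addr0 0) -{1}eP -eM !(mulmxDl, mulmxDr, mulmxN, mulNmx) e0 opprK.
  move: (u *m D *m c) (r *m D *m v) (r *m D *m c) => x y z.
  by apply/matrixP=> i j; rewrite !mxE; ring.
move/eqP; rewrite scaler_eq0 => /orP[two0|/eqP //].
by case/negP: ch2; rewrite inE.
Qed.

Lemma cross_block_sum (F : fieldType) (m : nat) (r : 'rV[F]_m) (c : 'cV[F]_m) :
  block_mx 0 r c 0 =
    \sum_i r 0 i *: block_mx 0 (delta_mx 0 i) 0 0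
    + \sum_i c i 0 *: block_mx 0 0 (delta_mx i 0) 0 :> 'M[F]_(1 + m).
Proof.
have -> : block_mx 0 r c 0 = block_mx 0 r 0 0 + block_mx 0 0 c 0 :> 'M[F]_(1 + m).
  by rewrite add_block_mx !addr0 add0r.
congr (_ + _).
  rewrite [in LHS](row_sum_delta r).
  elim/big_rec2: _ => [|i B1 B2 _ <-]; first by rewrite block_mx0.
  by rewrite scale_block_mx add_block_mx !scaler0 !addr0.
have Ec : c = \sum_i c i 0 *: delta_mx i 0.
  by rewrite [LHS]matrix_sum_delta; apply: eq_bigr => i _; rewrite big_ord1.
rewrite [in LHS]Ec.
elim/big_rec2: _ => [|i B1 B2 _ <-]; first by rewrite block_mx0.
by rewrite scale_block_mx add_block_mx !scaler0 !addr0.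
Qed.

Section CornerTriangular.

Variables (F : finFieldType) (m : nat) (S : {vspace 'M[F]_(1 + m)}).
Hypothesis ch2 : 2%N \notin [pchar F].
Hypothesis splS : split_space S.
Hypothesis ES : block_mx 1%:M 0 0 0 \in S.
Hypothesis upS : forall A, A \in S -> drsubmx A \in upper_trig_mx F m.
Hypothesis dimS : \dim S = 'C(m.+2, 2).

Let K := cross_space S.

Let row_support : pred 'I_m := fun i => [exists A in K, ursubmx A 0 i != 0].
Let col_support : pred 'I_m := fun i => [exists A in K, dlsubmx A i 0 != 0].

(** The cross space and the corner account for at most [m + 1] dimensions, which
    leaves the full triangular space for the lower right blocks. *)
Lemma dr_onto T : T \in upper_trig_mx F m -> exists2 A, A \in S & drsubmx A = T.
Proof.
move=> upT; suff /memv_imgP[A AS ->] : T \in (drL F m @: S)%VS.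
  by exists A => //; rewrite drLE.
apply: upper_sub_full_dim upT.
  by move=> _ /memv_imgP[A AS ->]; rewrite drLE upS.
rewrite -(leq_add2l m.+1) -binS2 -dimS.
exact: leq_dim_corner.
Qed.

(** Lift [T] to an element [B] of [S]; the relation [u D v = 0] at [B], [B + A]
    and [B - A] isolates the part that is quadratic in [A]. *)
Lemma cross_upper_eq0 A T : A \in K -> T \in upper_trig_mx F m ->
  ursubmx A *m T *m dlsubmx A = 0.
Proof.
move=> AK /dr_onto[B BS <-]; have [AS EA] := cross_spaceP _ _ AK.
have PS : block_mx (ulsubmx B) (ursubmx B + ursubmx A) (dlsubmx B + dlsubmx A)
    (drsubmx B) \in S.
  move: (memvD BS AS); rewrite -[X in X + _]submxK [X in _ + X]EA add_block_mx !addr0.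
  by move=> PS; exact PS.
have MS : block_mx (ulsubmx B) (ursubmx B - ursubmx A) (dlsubmx B - dlsubmx A)
    (drsubmx B) \in S.
  have := memvB BS AS; rewrite -[X in X - _]submxK [X in _ - X]EA.
  rewrite opp_block_mx add_block_mx !oppr0 !addr0.
  by move=> MS; exact MS.
have [_ eB _] := corner_submx ch2 splS ES BS.
have [_ eP _] := corner_block ch2 splS ES PS.
have [_ eM _] := corner_block ch2 splS ES MS.
exact: parallelogram_eq0 ch2 eB eP eM.
Qed.

(** Take [T = delta_mx i j], which is upper triangular when [i <= j]. *)
Lemma row_mul_col_entry0 A (i j : 'I_m) :
  A \in K -> (i <= j)%N -> ursubmx A 0 i * dlsubmx A j 0 = 0.
Proof.
move=> AK ij; have upT : delta_mx i j \in upper_trig_mx F m.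
  apply/upper_trig_mxP=> k l lk; rewrite mxE; case: andP => // -[/eqP ki /eqP lj].
  by move: lk; rewrite ki lj ltnNge ij.
have /matrixP/(_ 0 0) := cross_upper_eq0 AK upT.
rewrite [RHS]mxE mxE (bigD1 j) //= big1 => [|k kj]; last first.
  rewrite mxE big1 ?mul0r // => l _.
  by rewrite [delta_mx _ _ _ _]mxE (negPf kj) andbF mulr0.
rewrite addr0 mxE (bigD1 i) //= big1 => [|k ki]; last first.
  by rewrite [delta_mx _ _ _ _]mxE (negPf ki) mulr0.
by rewrite addr0 [delta_mx _ _ _ _]mxE !eqxx mulr1.
Qed.

(** A vector space is not the union of two proper subspaces: if neither
    coordinate vanishes identically, the sum of two witnesses has a nonzero
    product of coordinates. *)
Lemma supports_exclusive (i j : 'I_m) : (i <= j)%N -> row_support i -> ~~ col_support j.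
Proof.
move=> ij /exists_inP[A AK Ai]; apply/exists_inP=> -[B BK Bj].
have := row_mul_col_entry0 AK ij; have := row_mul_col_entry0 BK ij.
move/eqP; rewrite mulf_eq0 (negPf Bj) orbF => /eqP Bi.
move/eqP; rewrite mulf_eq0 (negPf Ai) /= => /eqP Aj.
have := row_mul_col_entry0 (memvD AK BK) ij.
have -> : ursubmx (A + B) 0 i = ursubmx A 0 i.
  by rewrite -[ursubmx (A + B)]urLE linearD /= !urLE mxE Bi addr0.
have -> : dlsubmx (A + B) j 0 = dlsubmx B j 0.
  by rewrite -[dlsubmx (A + B)]dlLE linearD /= !dlLE mxE Aj add0r.
by apply/eqP; rewrite mulf_neq0.
Qed.

Let gens : seq 'M[F]_(1 + m) :=
  image (fun i => block_mx 0 (delta_mx 0 i) 0 0) row_support ++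
  image (fun i => block_mx 0 0 (delta_mx i 0) 0) col_support.

Lemma cross_sub_gens : (K <= <<gens>>)%VS.
Proof.
apply/subvP=> A AK; have [_ ->] := cross_spaceP _ _ AK.
rewrite cross_block_sum.
apply: memvD; apply: memv_suml => i _.
  have [->|Ai] := eqVneq (ursubmx A 0 i) 0; first by rewrite scale0r mem0v.
  apply/memvZ/memv_span; rewrite mem_cat; apply/orP; left.
  by apply: image_f; apply/exists_inP; exists A.
have [->|Ai] := eqVneq (dlsubmx A i 0) 0; first by rewrite scale0r mem0v.
apply/memvZ/memv_span; rewrite mem_cat; apply/orP; right.
by apply: image_f; apply/exists_inP; exists A.
Qed.

Lemma cross_dim_ge : (m <= \dim K)%N.
Proof.
have le1 : (\dim (drL F m @: S) <= 'C(m.+1, 2))%N.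
  by apply: leq_dim_split_space ch2 _; apply: split_space_dr ch2 splS ES.
have := limg_ker_dim (drL F m) S; have := leq_dim_ul (S :&: lker (drL F m)).
rewrite -/(cross_space S) -/K dimS binS2; move: le1.
move: (\dim _) (\dim _) (\dim _) 'C(_, _) => *; lia.
Qed.

(** The two supports are disjoint, so [gens] has at most [m] elements; as its
    span contains [K], whose dimension is at least [m], it has exactly [m]. *)
Lemma supports_partition :
  (forall i, row_support i = ~~ col_support i) /\ (<<gens>> <= K)%VS.
Proof.
have exc i : row_support i -> ~~ col_support i by apply: supports_exclusive.
have sub : row_support \subset [predC col_support] by apply/subsetP.
have le_sz : (size gens <= m)%N.
  rewrite size_cat !size_image -[X in (_ <= X)%N]card_ord -(cardC col_support) addnC.
  by rewrite leq_add2l subset_leq_card.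
have le_span := dim_span gens.
split.
  have : (#|[predC col_support]| <= #|row_support|)%N.
    have := leq_trans cross_dim_ge (leq_trans (dimvS cross_sub_gens) le_span).
    rewrite size_cat !size_image -[X in (X <= _)%N]card_ord -(cardC col_support) addnC.
    by rewrite leq_add2r.
  move=> le_card i; have eq_card : #|row_support| = #|[predC col_support]|.
    by apply/eqP; rewrite eqn_leq le_card subset_leq_card.
  exact: (subset_cardP eq_card sub i).
have : K == <<gens>>%VS.
  by rewrite eqEdim cross_sub_gens (leq_trans le_span (leq_trans le_sz cross_dim_ge)).
by move/eqP=> <-.
Qed.

(** The matrix [(0, e_i; 0, 0)] lies in [S] and constrains the column of every
    element of [S]. *)
Lemma row_support_dl0 A i : A \in S -> row_support i -> dlsubmx A i 0 = 0.
Proof.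
move=> AS Ri; have [_ /subvP gK] := supports_partition.
have /gK/cross_spaceP[BS _] : block_mx 0 (delta_mx 0 i) 0 0 \in <<gens>>%VS.
  apply: memv_span; rewrite mem_cat; apply/orP; left; exact: image_f.
have := row_mulmx_col_eq0 ch2 splS BS (a := ulsubmx A) (u := ursubmx A)
  (v := dlsubmx A) (D := drsubmx A).
rewrite submxK => /(_ AS) /matrixP/(_ 0 0).
by rewrite -rowE !mxE.
Qed.

(** The matrix [A + (0, 0; e_i, 0)] lies in [S] together with [A], so the scalar
    [u v] vanishes on both. *)
Lemma col_support_ur0 A i : A \in S -> col_support i -> ursubmx A 0 i = 0.
Proof.
move=> AS Ci; have [_ /subvP gK] := supports_partition.
have /gK/cross_spaceP[BS _] : block_mx 0 0 (delta_mx i 0) 0 \in <<gens>>%VS.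
  apply: memv_span; rewrite mem_cat; apply/orP; right; exact: image_f.
have [eA _ _] := corner_submx ch2 splS ES AS.
have := memvD AS BS; rewrite -[X in X + _]submxK add_block_mx !addr0.
move=> /(corner_block ch2 splS ES)[+ _ _].
rewrite mulmxDr eA add0r -colE => /matrixP/(_ 0 0).
by rewrite !mxE.
Qed.

(** The row support is a final segment [k <= i] and the column support its
    complement, so it suffices to move the first basis vector to position
    [k]. *)
Lemma corner_trig : simultaneously_trig S.
Proof.
have [part _] := supports_partition.
have [k kP] : exists k : 'I_m.+1, forall i : 'I_m, row_support i = (k <= i)%N.
  apply: upward_closed_threshold => i j ij /(supports_exclusive ij).
  by rewrite part.
pose s : 'S_(1 + m) := lift_perm ord0 k 1.
have s0 : s (lshift m ord0) = k.
  by rewrite -[RHS](lift_perm_id ord0 k 1); congr (s _); apply: val_inj.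
have s1 i : s (rshift 1 i) = lift k i.
  by rewrite -[i in RHS](perm1 i) -(lift_perm_lift ord0); congr (s _); apply: val_inj.
exists (perm_mx s); first exact: unitmx_perm.
move=> A AS; have -> : invmx (perm_mx s) = perm_mx s^-1 :> 'M[F]_(1 + m).
  by apply: invmx_uniq; rewrite -perm_mxM mulgV perm_mx1.
rewrite -row_permE -[s in perm_mx s]invgK -col_permE.
apply/upper_trig_mxP=> i j; rewrite !mxE -{1}[i](permKV s) -{1}[j](permKV s).
move: (s^-1 i)%g (s^-1 j)%g => a b {i j}.
rewrite -[A]submxK.
case: (split_ordP a) => {}a ->; case: (split_ordP b) => {}b ->.
- by rewrite !ord1 ltnn.
- rewrite block_mxEur (ord1 a) s0 s1 /= => bk.
  apply: (col_support_ur0 AS); apply: negbNE; rewrite -part kP.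
  by move: bk; apply: contraTN => kb; rewrite -leqNgt /bump kb leqW.
- rewrite block_mxEdl (ord1 b) s0 s1 /= => ka.
  apply: (row_support_dl0 AS); rewrite kP; move: ka.
  apply: contraTT; rewrite -leqNgt -ltnNge => ak.
  by rewrite /bump (leqNgt k) ak ltnW.
- rewrite block_mxEdr !s1 /= => ba.
  have /upper_trig_mxP-> // := upS AS.
  by move: ba; rewrite !ltnNge leq_bump2.
Qed.

End CornerTriangular.

(** * Spaces of maximal dimension *)

(** Two successive conjugations reduce to [corner_trig]: the first brings the
    idempotent [(1, r; 0, 0)] to [(1, 0; 0, 0)], and the second, given by the
    induction hypothesis, acts on the lower right blocks only. *)
Theorem split_space_full_dim_trig (F : finFieldType) (n : nat) (S : {vspace 'M[F]_n}) :
  2%N \notin [pchar F] -> split_space S -> \dim S = 'C(n.+1, 2) ->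
  simultaneously_trig S.
Proof.
move=> ch2; elim: n S => [S _ _|m IHm].
  by exists 1%:M => [|A _]; [apply: unitmx1 | apply/upper_trig_mxP => -[]].
rewrite -[m.+1]/(1 + m)%N => S splS dimS.
have [r rS] : exists r, block_mx 1%:M r 0 0 \in S.
  apply: (full_dim_corner ch2 splS); rewrite dimS binS2 leq_add2l.
  exact: leq_dim_split_space ch2 (split_space_compression splS).
pose P : 'M[F]_(1 + m) := block_mx 1%:M (- r) 0 1%:M.
have PV : P *m block_mx 1%:M r 0 1%:M = 1%:M.
  rewrite mulmx_block !mulmx0 !mul0mx !mulmx1 !mul1mx !addr0 !add0r subrr.
  by rewrite -scalar_mx_block.
have [Pu _] := mulmx1_unit PV.
apply: (simultaneously_trig_conj Pu).
have ES : block_mx 1%:M 0 0 0 \in (conjL P @: S)%VS.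
  apply/memv_imgP; exists (block_mx 1%:M r 0 0) => //.
  rewrite conjLE (invmx_uniq PV) !mulmx_block.
  by rewrite !(mulmx0, mul0mx, mulmx1, mul1mx, addr0, add0r) addNr.
move: (split_space_conj Pu splS) (dim_conj Pu S) ES.
move: (conjL P @: S)%VS => S1 splS1; rewrite dimS => dimS1 ES1 {splS dimS rS}.
have [Q Qu trigQ] : simultaneously_trig (drL F m @: S1)%VS.
  have splD := split_space_dr ch2 splS1 ES1.
  apply: IHm => //; apply/eqP; rewrite eqn_leq (leq_dim_split_space ch2 splD).
  by rewrite -(leq_add2l m.+1) -binS2 -dimS1 leq_dim_corner.
pose P1 : 'M[F]_(1 + m) := block_mx 1%:M 0 0 Q.
have P1V : P1 *m block_mx 1%:M 0 0 (invmx Q) = 1%:M.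
  rewrite mulmx_block !(mulmx0, mul0mx, mulmx1, mul1mx, addr0, add0r) mulmxV //.
  by rewrite -scalar_mx_block.
have [P1u _] := mulmx1_unit P1V.
have conjE (A : 'M_(1 + m)) : conjL P1 A = block_mx (ulsubmx A) (ursubmx A *m Q)
    (invmx Q *m dlsubmx A) (invmx Q *m drsubmx A *m Q).
  rewrite conjLE (invmx_uniq P1V) -[A in LHS]submxK !mulmx_block.
  by rewrite !(mulmx0, mul0mx, mulmx1, mul1mx, addr0, add0r).
apply: (simultaneously_trig_conj P1u); apply: corner_trig => //.
- exact: split_space_conj.
- apply/memv_imgP; exists (block_mx 1%:M 0 0 0) => //.
  rewrite conjE block_mxKul block_mxKur block_mxKdl block_mxKdr.
  by rewrite !(mulmx0, mul0mx).
- move=> _ /memv_imgP[A AS ->]; rewrite conjE block_mxKdr.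
  by have := trigQ _ (memv_img (drL F m) AS); rewrite drLE.
- by rewrite dim_conj.
Qed.

Lemma triangularizable_splits (F : fieldType) (n : nat) (A : 'M[F]_n) :
  triangularizable A -> splits (char_poly A).
Proof.
case=> P Pu [B upB ->].
have -> : char_poly (P *m B *m invmx P) = char_poly B.
  by rewrite -{1}[P]invmxK char_poly_conj // unitmx_inv.
have -> : char_poly B = char_poly B^T.
  by rewrite /char_poly -det_tr /char_poly_mx linearB /= tr_scalar_mx map_trmx.
exists [seq B^T i i | i <- enum 'I_n].
by rewrite big_map big_enum /= char_poly_trig // eqpxx.
Qed.

Theorem theorem1p4 (F : finFieldType) (n : nat) (S : {vspace 'M[F]_n}) :
  2%N \notin [pchar F] ->
  (1 <= n)%N ->
  weakly_triangularizable (mem S) ->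
  \dim S = ((n * (n + 1)) %/ 2)%N ->
  similar_subsets (mem S) (upper_trig_mx F n).
Proof.
move=> ch2 _ wtS; have -> : ((n * (n + 1)) %/ 2)%N = 'C(n.+1, 2).
  by rewrite bin2 /= addn1 mulnC divn2.
move=> dimS.
have splS : split_space S by move=> A AS; apply/triangularizable_splits/wtS.
have [P Pu trigP] := split_space_full_dim_trig ch2 splS dimS.
exists P => // A; split=> [AS|[B upB ->]].
  exists (invmx P *m A *m P); first exact: trigP.
  by rewrite !mulmxA mulmxV // mul1mx mulmxK.
have /memv_imgP[A' AS ->] : B \in (conjL P @: S)%VS.
  apply: upper_sub_full_dim upB; last by rewrite dim_conj // dimS.
  by move=> _ /memv_imgP[A' AS ->]; rewrite conjLE trigP.
by rewrite conjLE !mulmxA mulmxV // mul1mx mulmxK.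
Qed.
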